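(* Let $m\ge2$ and let $\alpha\ge m+1$. Any body $\Omega$ in $\mathbb{R}^m$ with a piecewise $C^1$ boundary has a unique $r^{\alpha-m}$-center.
   Context: A body is a compact subset of $\mathbb{R}^m$ that is the closure of its interior. $\mu$ is Lebesgue measure on $\mathbb{R}^m$. For $\alpha>0$ put $V^{(\alpha)}_\Omega(x)=\int_{\Omega}|x-y|^{\alpha-m}\,d\mu(y)$, $x\in\mathbb{R}^m$. For $\alpha>m$, an $r^{\alpha-m}$-center of $\Omega$ is a point of $\mathbb{R}^m$ at which the minimum value of $V_\Omega^{(\alpha)}$ on $\mathbb{R}^m$ is attained. *)

(* Defs.v *)
From HB Require Import structures.
From mathcomp Require Import all_boot all_order all_algebra.
From mathcomp Require Import all_classical all_reals all_analysis.

Set Implicit Arguments.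
Unset Strict Implicit.
Unset Printing Implicit Defensive.

Import Order.TTheory GRing.Theory Num.Theory.
Import numFieldNormedType.Exports.

Local Open Scope classical_set_scope.
Local Open Scope ring_scope.

(** The sigma-algebra on [R^n] is the product of [n] copies of the Borel
    sigma-algebra of [R]; it is the Borel sigma-algebra of [R^n], see
    [open_measurable_rV] below. *)

Definition measure_rV_display : measure_display.
Proof. exact: default_measure_display. Qed.

Section measurable_rV.
Context (R : realType) (n : nat).

Definition coord_rV (i : 'I_n) (x : 'rV[R]_n) : measurableTypeR R := x ord0 i.

Let rV_set0 : g_sigma_preimage coord_rV set0.
Proof. exact: sigma_algebra0. Qed.

Let rV_setC A : g_sigma_preimage coord_rV A -> g_sigma_preimage coord_rV (~` A).
Proof. exact: sigma_algebraC. Qed.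

Let rV_bigcup (F : _^nat) : (forall i, g_sigma_preimage coord_rV (F i)) ->
  g_sigma_preimage coord_rV (\bigcup_i F i).
Proof. exact: sigma_algebra_bigcup. Qed.

HB.instance Definition _ := @isMeasurable.Build measure_rV_display
  'rV[R]_n (g_sigma_preimage coord_rV) rV_set0 rV_setC rV_bigcup.

Lemma measurable_coord_rV (i : 'I_n) : measurable_fun setT (coord_rV i).
Proof.
move=> _ Y mY; rewrite setTI; apply: sub_sigma_algebra => /=.
rewrite -bigcup_seq/=; exists i => /=; first by rewrite mem_index_enum.
by exists Y => //; rewrite setTI.
Qed.

Lemma measurable_fun_rVP d (T : measurableType d) (f : T -> 'rV[R]_n) :
  (forall i, measurable_fun setT (coord_rV i \o f)) -> measurable_fun setT f.
Proof.
move=> mf.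
have sub : g_sigma_preimage (fun i => coord_rV i \o f) `<=` measurable.
  apply: smallest_sub; first exact: sigma_algebra_measurable.
  rewrite -bigcup_seq/= => A [i _ [B mB <-]].
  exact: mf.
by move=> _ A mA; apply: sub; rewrite g_sigma_preimage_comp; exists A.
Qed.

Lemma measurable_box (A : 'I_n -> set (measurableTypeR R)) :
  (forall i, measurable (A i)) ->
  measurable [set x : 'rV[R]_n | forall i, A i (x ord0 i)].
Proof.
move=> mA; rewrite (_ : mkset _ =
    \big[setI/setT]_(i < n) (coord_rV i @^-1` A i)); last first.
  rewrite -bigcap_seq; apply/seteqP; split => x /=; first by move=> Ax i _.
  by move=> Ax i; apply: (Ax i); rewrite /= mem_index_enum.
apply: bigsetI_measurable => i _.
by rewrite -[X in measurable X]setTI; exact: measurable_coord_rV.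
Qed.

Lemma open_measurable_rV (A : set 'rV[R]_n) : open A -> measurable A.
Proof.
move=> oA.
pose c (q : 'rV[rat]_n) : 'rV[R]_n := map_mx ratr q.
pose B (p : 'rV[rat]_n * nat) := ball (c p.1) (p.2.+1%:R^-1 : R).
pose D := [set p | B p `<=` A].
have mB p : measurable (B p).
  rewrite (_ : B p = [set x : 'rV[R]_n |
      forall i, ball (c p.1 ord0 i) (p.2.+1%:R^-1 : R) (x ord0 i)]).
    apply: (@measurable_box (fun i => ball (c p.1 ord0 i) (p.2.+1%:R^-1 : R))).
    by move=> i; rewrite ball_itv; exact: measurable_itv.
  apply/seteqP; split => x; rewrite /B /ball /=.
    by move=> [_ xB] i; exact: xB.
  move=> xB; split; first by rewrite invr_gt0 ltr0n.
  by move=> i j; rewrite (ord1 i); exact: xB.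
rewrite (_ : A = \bigcup_(p in D) B p); last first.
  apply/seteqP; split; last by move=> x [p]; exact.
  move=> x Ax; move: (oA); rewrite openE => /(_ _ Ax).
  move=> /nbhs_ballP[e /= e0 xeA].
  have [k ke] : exists k : nat, k.+1%:R^-1 < e / 2.
    have e20 : 0 < e / 2 by rewrite divr_gt0.
    have [k _ /(_ k (leqnn k))] := near_infty_natSinv_lt (PosNum e20).
    by exists k.
  have q_ i : exists q : rat, `|x ord0 i - ratr q| < k.+1%:R^-1.
    have h : x ord0 i - k.+1%:R^-1 < x ord0 i + k.+1%:R^-1.
      by rewrite ltrD2l gtrN// invr_gt0 ltr0n.
    have [q] := rat_in_itvoo h; rewrite in_itv/= => /andP[q1 q2].
    by exists q; rewrite distrC ltr_distl q1 q2.
  pose q : 'rV[rat]_n := \row_i sval (cid (q_ i)).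
  have k0 : 0 < k.+1%:R^-1 :> R by rewrite invr_gt0 ltr0n.
  have xq : B (q, k) x.
    split => //= i j; rewrite (ord1 i) !mxE /ball/= distrC.
    by case: cid.
  exists (q, k) => //= y yB; apply: xeA.
  apply: (@le_ball _ _ _ (k.+1%:R^-1 + k.+1%:R^-1)).
    by rewrite (splitr e) lerD// ltW.
  by apply: ball_triangle yB; exact: ball_sym.
rewrite bigcup_mkcond; apply: countable_bigcupT_measurable => [|p].
  exact: countableP.
by case: ifPn.
Qed.

End measurable_rV.

(** Lebesgue measure on [R^n], by recursion on [n]: the point mass on [R^0],
    then the image of the product measure on [R * R^n] under
    [(t, x) |-> (t, x_0, ..., x_(n-1))]. *)

Section lebesgue_rV.
Context (R : realType).

Definition cons_rV n (p : measurableTypeR R * 'rV[R]_n) : 'rV[R]_n.+1 :=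
  row_mx (const_mx p.1 : 'rV[R]_1) p.2.

Definition uncons_rV n (x : 'rV[R]_n.+1) : measurableTypeR R * 'rV[R]_n :=
  (x ord0 ord0, \row_j x ord0 (lift ord0 j)).

Lemma cons_rV0 n p : @cons_rV n p ord0 ord0 = p.1.
Proof.
rewrite /cons_rV mxE; case: splitP => [j _|j /eqP//]; by rewrite mxE.
Qed.

Lemma cons_rVS n p j : @cons_rV n p ord0 (lift ord0 j) = p.2 ord0 j.
Proof.
rewrite /cons_rV mxE; case: splitP => [i|i].
  by case: i => -[].
by rewrite lift0 => -[/val_inj ->].
Qed.

Lemma cons_rVK n : cancel (@cons_rV n) (@uncons_rV n).
Proof.
move=> [t x]; rewrite /uncons_rV cons_rV0; congr (_, _).
by apply/rowP => j; rewrite mxE cons_rVS.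
Qed.

Lemma measurable_cons_rV n : measurable_fun setT (@cons_rV n).
Proof.
apply: measurable_fun_rVP => i; have [j ->|->] := unliftP ord0 i.
  rewrite (_ : _ \o _ = coord_rV j \o snd); last first.
    by apply/funext => p; rewrite /= /coord_rV cons_rVS.
  apply: measurableT_comp => //; exact: measurable_coord_rV.
rewrite (_ : _ \o _ = fst)//.
by apply/funext => p; rewrite /= /coord_rV cons_rV0.
Qed.

Lemma measurable_uncons_rV n : measurable_fun setT (@uncons_rV n).
Proof.
apply: measurable_fun_pair; first exact: (measurable_coord_rV ord0).
apply: measurable_fun_rVP => i.
rewrite (_ : _ \o _ = coord_rV (lift ord0 i)); last first.
  by apply/funext => x; rewrite /= /coord_rV mxE.
exact: measurable_coord_rV.
Qed.

Section lebesgue_rV_succ.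
Local Open Scope ereal_scope.
Variables (n : nat) (mu : {sigma_finite_measure set 'rV[R]_n -> \bar R}).

Definition lebesgue_rV_succ : set 'rV[R]_n.+1 -> \bar R :=
  pushforward (@lebesgue_measure R \x mu) (@cons_rV n).

Let succ0 : lebesgue_rV_succ set0 = 0.
Proof. by rewrite /lebesgue_rV_succ /pushforward preimage_set0 measure0. Qed.

Let succ_ge0 A : 0 <= lebesgue_rV_succ A.
Proof. by rewrite /lebesgue_rV_succ /pushforward; exact: measure_ge0. Qed.

Let succ_sigma_additive : semi_sigma_additive lebesgue_rV_succ.
Proof.
move=> F mF tF mUF; rewrite /lebesgue_rV_succ /pushforward preimage_bigcup.
have mpre A : measurable A -> measurable (@cons_rV n @^-1` A).
  by move=> mA; rewrite -[X in measurable X]setTI; exact: measurable_cons_rV.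
apply: measure_semi_sigma_additive.
- by move=> k; exact: mpre.
- move=> i j _ _ [p [Fip Fjp]]; apply: tF => //.
  by exists (cons_rV p).
- by rewrite -preimage_bigcup; exact: mpre.
Qed.

HB.instance Definition _ := isMeasure.Build _ _ _
  lebesgue_rV_succ succ0 succ_ge0 succ_sigma_additive.

Let succ_sigma_finite : sigma_finite setT lebesgue_rV_succ.
Proof.
have /sigma_finiteP[F [TF ndF Foo]] := sigma_finiteT (@lebesgue_measure R).
have /sigma_finiteP[G [TG ndG Goo]] := sigma_finiteT mu.
exists (fun k => @uncons_rV n @^-1` (F k `*` G k)) => [|k].
  apply/seteqP; split => // x _.
  have [i _ Fi] : (\bigcup_i F i) (uncons_rV x).1 by rewrite -TF.
  have [j _ Gj] : (\bigcup_i G i) (uncons_rV x).2 by rewrite -TG.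
  exists (maxn i j) => //; split.
    by move: Fi; exact/subsetPset/ndF/leq_maxl.
  by move: Gj; exact/subsetPset/ndG/leq_maxr.
have [mF Fk] := Foo k; have [mG Gk] := Goo k; split.
  rewrite -[X in measurable X]setTI; apply: measurable_uncons_rV => //.
  exact: measurableX.
rewrite /lebesgue_rV_succ /pushforward (_ : _ @^-1` _ = F k `*` G k).
  by rewrite product_measure1E// lte_mul_pinfty// ge0_fin_numE.
apply/funext => p.
by rewrite -[RHS]/((F k `*` G k) p) -[in RHS](cons_rVK p).
Qed.

HB.instance Definition _ := Measure_isSigmaFinite.Build _ _ _
  lebesgue_rV_succ succ_sigma_finite.

End lebesgue_rV_succ.

Fixpoint lebesgue_rV n : {sigma_finite_measure set 'rV[R]_n -> \bar R} :=
  match n with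
  | 0 => \d_(0 : 'rV[R]_0)
  | k.+1 => lebesgue_rV_succ (lebesgue_rV k)
  end.

Lemma lebesgue_rV_box n (a b : 'rV[R]_n) : (forall i, a ord0 i <= b ord0 i) ->
  lebesgue_rV n [set x | forall i, x ord0 i \in `[a ord0 i, b ord0 i]] =
  (\prod_(i < n) (b ord0 i - a ord0 i))%:E.
Proof.
elim: n a b => [|n IH] a b ab.
  by rewrite big_ord0 /= diracE mem_set// => -[].
rewrite [LHS]/= /lebesgue_rV_succ /pushforward.
pose a' : 'rV[R]_n := \row_j a ord0 (lift ord0 j).
pose b' : 'rV[R]_n := \row_j b ord0 (lift ord0 j).
rewrite (_ : _ @^-1` _ = `[a ord0 ord0, b ord0 ord0] `*`
    [set x : 'rV[R]_n | forall i, x ord0 i \in `[a' ord0 i, b' ord0 i]]).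
  rewrite product_measure1E//.
    rewrite IH => [|i]; last by rewrite !mxE.
    rewrite big_ord_recl EFinM; congr (_ * _)%E; last first.
      by congr EFin; apply: eq_bigr => i _; rewrite !mxE.
    apply: etrans (lebesgue_measure_itv _) _; rewrite /= lte_fin.
    case: ltP => // ba; have -> : a ord0 ord0 = b ord0 ord0.
      by apply/eqP; rewrite eq_le ba ab.
    by rewrite subrr.
  apply: (@measurable_box _ _ (fun i => `[a' ord0 i, b' ord0 i]%classic)) => i.
  exact: measurable_itv.
apply/seteqP; split => p /=.
  move=> h; split; first by have := h ord0; rewrite cons_rV0.
  by move=> i; have := h (lift ord0 i); rewrite cons_rVS !mxE.
move=> [h0 h] i; have [j ->|->] := unliftP ord0 i; last by rewrite cons_rV0.
by rewrite cons_rVS; have := h j; rewrite !mxE.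
Qed.

End lebesgue_rV.

Section bodies.
Context (R : realType).

(** The library norm on ['rV[R]_n] is the sup norm, hence this definition. *)
Definition enorm n (x : 'rV[R]_n) : R := Num.sqrt (\sum_(i < n) x ord0 i ^+ 2).

(** Nonemptiness is part of the notion: the empty set is compact and regular
    closed, and its potential vanishes identically. *)
Definition is_body n (Omega : set 'rV[R]_n) : Prop :=
  [/\ Omega !=set0, compact Omega & regclosed Omega].

Definition boundary n (A : set 'rV[R]_n) : set 'rV[R]_n := closure A `\` A°.

Definition unit_cube k : set 'rV[R]_k :=
  [set u | forall i, 0 <= u ord0 i <= 1].

Definition C1_on k n (U : set 'rV[R]_k) (f : 'rV[R]_k -> 'rV[R]_n) : Prop :=
  forall u, U u -> differentiable f u /\ {for u, continuous (jacobian f)}.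

(** A [C^1] parametrized piece of hypersurface: [C^1] up to the boundary of the
    parameter cube, and a regular (injective, immersive) parametrization in its
    interior. Regularity is not demanded on the boundary of the cube, so that
    conical points and edges glued to themselves are allowed. *)
Definition C1_patch n (f : 'rV[R]_n.-1 -> 'rV[R]_n) : Prop :=
  [/\ exists U : set 'rV[R]_n.-1,
        [/\ open U, @unit_cube n.-1 `<=` U & C1_on U f],
      set_inj (@unit_cube n.-1)° f &
      forall u, (@unit_cube n.-1)° u -> row_free (jacobian f u)].

(** [S] is a finite union of [C^1] patches with pairwise disjoint relative
    interiors. *)
Definition piecewise_C1 n (S : set 'rV[R]_n) : Prop :=
  exists (N : nat) (f : 'I_N -> 'rV[R]_n.-1 -> 'rV[R]_n),
    [/\ forall i, C1_patch (f i),
        S = \bigcup_i (f i @` @unit_cube n.-1) &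
        trivIset setT (fun i => f i @` (@unit_cube n.-1)°)].

Definition potential n (alpha : R) (Omega : set 'rV[R]_n) (x : 'rV[R]_n) :
    \bar R :=
  (\int[lebesgue_rV R n]_(y in Omega) (enorm (x - y) `^ (alpha - n%:R))%:E)%E.

Definition is_center n (alpha : R) (Omega : set 'rV[R]_n) (x : 'rV[R]_n) :
    Prop :=
  forall z, (potential alpha Omega x <= potential alpha Omega z)%E.

End bodies.

(* Main.v *)
Require Import Defs.
From mathcomp Require Import all_boot all_order all_algebra.
From mathcomp Require Import all_classical all_reals all_analysis.
From mathcomp Require Import measurable_realfun ring lra.

Set Implicit Arguments.
Unset Strict Implicit.
Unset Printing Implicit Defensive.

Import Order.TTheory GRing.Theory Num.Theory.
Import numFieldNormedType.Exports.

Local Open Scope classical_set_scope.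
Local Open Scope ring_scope.

(** Put [p := alpha - m >= 1], so that the potential is
    [V x = \int_Omega |x - y|^p dy], and write [|.|] for the Euclidean norm.

    Existence.  On a ball of radius [M] the function [|.|^p] is Lipschitz
    ([enorm_powR_lipschitz]); since [Omega] is bounded and of finite measure,
    [V] is finite and locally Lipschitz, hence continuous
    ([continuous_potential]).  If [Omega] lies in the ball of radius [rho]
    about [0] and [|x| > 2 rho], then every point of [Omega] is farther from
    [x] than from [0], so [V 0 <= V x] ([potential_origin_le]).  A minimum of
    [V] on the compact cube of half-side [2 rho] is therefore a global one
    ([exists_center]).

    Uniqueness.  For fixed [y] the function [x |-> |x - y|^p] is convex,
    because [|.|] is convex and [t |-> t^p] is convex and increasing.  The
    midpoint inequality for the points [x0 != x1] is moreover strict at every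
    [y] off the line through [x0] and [x1]: there the triangle inequality
    between [x0 - y] and [x1 - y] is strict, even when [p = 1].  In dimension
    at least [2] a line contains no nonempty open set, so [Omega], which has
    interior points, has one off the line; by continuity the midpoint
    inequality has a gap bounded below on a small box inside [Omega].
    Integrating, [2 V ((x0 + x1) / 2) < V x0 + V x1]
    ([potential_midpoint_lt]), so that [x0] and [x1] cannot both be minimum
    points. *)

(** * The Euclidean norm *)

Section euclidean_norm.
Context (R : realType) (n : nat).
Implicit Types u v x z : 'rV[R]_n.

Lemma enorm_ge0 u : 0 <= enorm u.
Proof. exact: sqrtr_ge0. Qed.

Lemma sqr_enorm u : enorm u ^+ 2 = \sum_(i < n) u ord0 i ^+ 2.
Proof. by rewrite sqr_sqrtr// sumr_ge0// => i _; exact: sqr_ge0. Qed.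

Lemma enormZ (c : R) u : enorm (c *: u) = `|c| * enorm u.
Proof.
rewrite /enorm -sqrtr_sqr -sqrtrM ?sqr_ge0// mulr_sumr.
by congr Num.sqrt; apply: eq_bigr => i _; rewrite mxE exprMn.
Qed.

Lemma enormN u : enorm (- u) = enorm u.
Proof. by rewrite -scaleN1r enormZ normrN1 mul1r. Qed.

Lemma ler_coord_enorm u i : `|u ord0 i| <= enorm u.
Proof.
rewrite -sqrtr_sqr ler_wsqrtr// (bigD1 i)//= lerDl sumr_ge0// => j _.
exact: sqr_ge0.
Qed.

Lemma enorm_eq0 u : enorm u = 0 -> u = 0.
Proof.
move=> u0; apply/rowP => i; apply/eqP; rewrite mxE -normr_eq0 eq_le normr_ge0.
by rewrite -u0 ler_coord_enorm.
Qed.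

(** This identity contains both the triangle inequality, since its left-hand
    side is nonnegative, and the equality case, since its left-hand side
    vanishes only if [|v| u = |u| v]. *)
Lemma enorm_cross u v :
  enorm (enorm v *: u - enorm u *: v) ^+ 2 =
  enorm u * enorm v * ((enorm u + enorm v) ^+ 2 - enorm (u + v) ^+ 2).
Proof.
set a := enorm u; set b := enorm v.
pose s := \sum_(i < n) u ord0 i * v ord0 i.
have sqrD (c d : R) : enorm (c *: u + d *: v) ^+ 2 =
    c ^+ 2 * a ^+ 2 + d ^+ 2 * b ^+ 2 + 2 * c * d * s.
  rewrite /a /b !sqr_enorm /s !mulr_sumr -!big_split/=.
  by apply: eq_bigr => i _; rewrite !mxE; ring.
have := sqrD b (- a); rewrite scaleNr => ->.
by have := sqrD 1 1; rewrite !scale1r => ->; ring.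
Qed.

Lemma ler_enormD u v : enorm (u + v) <= enorm u + enorm v.
Proof.
have [u0|u0] := eqVneq (enorm u) 0.
  by rewrite (enorm_eq0 u0) add0r lerDr enorm_ge0.
have [v0|v0] := eqVneq (enorm v) 0.
  by rewrite (enorm_eq0 v0) addr0 lerDl enorm_ge0.
have uv : 0 < enorm u * enorm v.
  by rewrite mulr_gt0// lt_neqAle eq_sym ?u0 ?v0 enorm_ge0.
rewrite -ler_sqr ?nnegrE ?addr_ge0 ?enorm_ge0// -subr_ge0 -(pmulr_rge0 _ uv).
by rewrite -enorm_cross sqr_ge0.
Qed.

Lemma enormD_eq_colinear u v : enorm u + enorm v <= enorm (u + v) ->
  enorm v *: u = enorm u *: v.
Proof.
move=> le; have e : enorm (u + v) = enorm u + enorm v.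
  by apply/eqP; rewrite eq_le ler_enormD le.
apply/eqP; rewrite -subr_eq0; apply/eqP/enorm_eq0/eqP.
by rewrite -sqrf_eq0 enorm_cross e subrr mulr0.
Qed.

Lemma ler_enorm_sum u : enorm u <= \sum_(i < n) `|u ord0 i|.
Proof.
have s0 (s : seq 'I_n) : 0 <= \sum_(i <- s) `|u ord0 i|.
  by apply: sumr_ge0 => i _; exact: normr_ge0.
rewrite -ler_sqr ?nnegrE ?enorm_ge0 ?s0// sqr_enorm.
elim: (index_enum _) => [|i s IH]; first by rewrite !big_nil expr0n.
rewrite !big_cons sqrrD real_normK ?num_real// -addrA lerD2l.
by rewrite (le_trans IH)// lerDr mulrn_wge0// mulr_ge0.
Qed.

(** The balls of ['rV[R]_n] are those of the sup norm. *)
Lemma ball_enorm x z e : ball x e z -> enorm (x - z) <= n%:R * e.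
Proof.
move=> [e0 xz]; apply: (le_trans (ler_enorm_sum _)).
rewrite mulr_natl -[n in _ *+ n]card_ord -sumr_const ler_sum// => i _.
by rewrite !mxE ltW//; exact: xz.
Qed.

(** The one-sided bound suffices because [x] and [z] may be exchanged. *)
Lemma locally_lipschitz_continuous (f : 'rV[R]_n -> R) :
  (forall M, exists C, forall x z, enorm x <= M -> enorm z <= M ->
    f x <= f z + C * enorm (x - z)) ->
  continuous f.
Proof.
move=> lip x; apply/(@cvgrPdist_le _ _ _ (nbhs x)) => e e0.
(* The points near [x] considered below are at sup distance at most [1] from
   [x], hence in the Euclidean ball of radius [enorm x + n]. *)
have [C fC] := lip (enorm x + n%:R).
(* The term [+ 1] keeps the denominator positive when [n = 0]. *)
pose d := e / (n%:R * (`|C| + 1) + 1).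
have D0 : 0 < n%:R * (`|C| + 1) + 1 by rewrite ltr_pwDr// mulr_ge0// addr_ge0.
have d0 : 0 < d by rewrite divr_gt0.
apply/nbhs_ballP; exists (Num.min 1 d) => /=; first by rewrite lt_min ltr01.
move=> z xz; have le := ball_enorm xz.
have le1 : enorm (x - z) <= n%:R.
  by rewrite (le_trans le)// ler_piMr// ge_min lexx.
have Cd : `|C| * enorm (x - z) <= e.
  have led : enorm (x - z) <= n%:R * d.
    by rewrite (le_trans le)// ler_wpM2l// ge_min lexx orbT.
  rewrite (le_trans (ler_wpM2l _ led))// mulrCA mulrA.
  rewrite /d mulrA ler_pdivrMr// mulrC ler_wpM2l ?ltW//.
  by have := ler0n R n; lra.
have zM : enorm z <= enorm x + n%:R.
  rewrite -(subrK x z) addrC (le_trans (ler_enormD _ _))// lerD2l.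
  by rewrite -enormN opprB.
have xM : enorm x <= enorm x + n%:R by rewrite lerDl.
have CC : C * enorm (x - z) <= e.
  by rewrite (le_trans _ Cd)// ler_wpM2r ?enorm_ge0// ler_norm.
rewrite ler_norml; have := fC x z xM zM; have := fC z x zM xM.
by rewrite -[z - x]opprB enormN; lra.
Qed.

Lemma continuous_enorm : continuous (@enorm R n).
Proof.
apply: locally_lipschitz_continuous => M; exists 1 => x z _ _.
by rewrite mul1r addrC -{1}(subrK z x) ler_enormD.
Qed.

Lemma continuous_measurable_rV (f : 'rV[R]_n -> R) :
  continuous f -> measurable_fun setT f.
Proof.
move=> /continuousP cf.
apply: (measurability _ (RGenOpens.measurableE R)) => //.
move=> _ [_ [a [b ->] <-]]; rewrite setTI.
by apply: open_measurable_rV; apply: cf; apply: itv_open.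
Qed.

End euclidean_norm.

(** * Convexity of powers *)

Section power.
Context (R : realType) (p : R).
Hypothesis p1 : 1 <= p.

Lemma powR_convex (l s t : R) : 0 <= l <= 1 -> 0 <= s -> 0 <= t ->
  ((1 - l) * s + l * t) `^ p <= (1 - l) * s `^ p + l * t `^ p.
Proof.
move=> /andP[l0 l1] s0 t0.
have := convex_powR p1 (Itv01 l0 l1) (x := t) (y := s).
rewrite !inE/= !in_itv/= s0 t0 => /(_ isT isT).
by rewrite !convRE/= [X in X `^ _]addrC [X in _ -> _ <= X]addrC.
Qed.

(** The chord of the convex function [t |-> t^p] from [s] to [t] is less steep
    than the one from [s] to [t + 1], whose slope is at most [(t + 1)^p]
    because its run is at least [1]. *)
Lemma powR_slope (s t M : R) : 0 <= s -> s <= t -> t <= M ->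
  t `^ p <= s `^ p + (M + 1) `^ p * (t - s).
Proof.
move=> s0 st tM; pose l := (t - s) / (t + 1 - s).
have t1s : 0 < t + 1 - s by lra.
have l0 : 0 <= l by rewrite divr_ge0; lra.
have lts : l <= t - s.
  by rewrite /l ler_pdivrMr// ler_peMr; lra.
have l1 : l <= 1 by rewrite /l ler_pdivrMr//; lra.
have -> : t `^ p = ((1 - l) * s + l * (t + 1)) `^ p.
  by congr (_ `^ _); rewrite /l; field; lra.
have t10 : 0 <= t + 1 by lra.
have l01 : 0 <= l <= 1 by rewrite l0.
apply: (le_trans (powR_convex l01 s0 t10)).
clearbody l; apply: lerD; first by rewrite ler_piMl ?powR_ge0//; lra.
rewrite mulrC; apply: ler_pM => //; first by rewrite powR_ge0.
by apply: ge0_ler_powR; rewrite ?nnegrE ?(le_trans ler01 p1)//; lra.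
Qed.

End power.

(** * The kernel *)

Section kernel.
Context (R : realType) (n : nat) (p : R).
Hypothesis p1 : 1 <= p.
Implicit Types (u v x y : 'rV[R]_n).

Let p0 : 0 <= p. Proof. exact: le_trans ler01 p1. Qed.

Lemma enorm_powR_lipschitz M u v : enorm u <= M -> enorm v <= M ->
  enorm u `^ p <= enorm v `^ p + (M + 1) `^ p * enorm (u - v).
Proof.
move=> uM vM; have [uv|/ltW vu] := leP (enorm u) (enorm v).
  rewrite (le_trans (ge0_ler_powR p0 _ _ uv)) ?nnegrE ?enorm_ge0//.
  by rewrite lerDl mulr_ge0 ?powR_ge0 ?enorm_ge0.
rewrite (le_trans (powR_slope p1 (enorm_ge0 v) vu uM))// lerD2l.
rewrite ler_wpM2l ?powR_ge0// lerBlDr.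
by rewrite -{1}(subrK v u) ler_enormD.
Qed.

Lemma continuous_kernel x : continuous (fun y => enorm (x - y) `^ p).
Proof.
apply: locally_lipschitz_continuous => M.
exists ((enorm x + M + 1) `^ p) => y z yM zM.
rewrite -(enormN (y - z)).
have -> : - (y - z) = (x - y) - (x - z).
  by apply/rowP => k; rewrite !mxE; ring.
have bd w : enorm w <= M -> enorm (x - w) <= enorm x + M.
  by move=> wM; rewrite (le_trans (ler_enormD _ _))// enormN lerD2l.
by apply: enorm_powR_lipschitz; exact: bd.
Qed.

Let powR_mid u v : 2 * ((enorm u + enorm v) / 2) `^ p <=
  enorm u `^ p + enorm v `^ p.
Proof.
have half01 : 0 <= (2^-1 : R) <= 1 by apply/andP; split; lra.
have := powR_convex p1 half01 (enorm_ge0 u) (enorm_ge0 v).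
have -> : (1 - 2^-1) * enorm u + 2^-1 * enorm v = (enorm u + enorm v) / 2.
  by field.
by lra.
Qed.

Lemma kernel_midpoint_le u v : 2 * enorm (2^-1 *: (u + v)) `^ p <=
  enorm u `^ p + enorm v `^ p.
Proof.
apply: le_trans (powR_mid u v); rewrite ler_pM2l//.
apply: ge0_ler_powR => //; rewrite ?nnegrE ?enorm_ge0//.
  by rewrite divr_ge0 ?addr_ge0 ?enorm_ge0.
by rewrite enormZ gtr0_norm ?invr_gt0// mulrC ler_pM2r ?invr_gt0// ler_enormD.
Qed.

(** Strictness comes from the norm alone, not from the power, so that it also
    holds for [p = 1]. *)
Lemma kernel_midpoint_lt u v : enorm (u + v) < enorm u + enorm v ->
  2 * enorm (2^-1 *: (u + v)) `^ p < enorm u `^ p + enorm v `^ p.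
Proof.
move=> lt; apply: lt_le_trans (powR_mid u v); rewrite ltr_pM2l//.
apply: gt0_ltr_powR; rewrite ?nnegrE ?enorm_ge0//.
- exact: lt_le_trans ltr01 p1.
- by rewrite divr_ge0 ?addr_ge0 ?enorm_ge0.
- by rewrite enormZ gtr0_norm ?invr_gt0// mulrC ltr_pM2r ?invr_gt0.
Qed.

End kernel.

(** * Points off a line *)

Section off_line.
Context (R : realType) (n : nat).
Implicit Types x y : 'rV[R]_n.

(** The determinant condition says that, already in the coordinates [i] and
    [j], the point [y] is off the line through [x0] and [x1].  Equality in the
    triangle inequality would give [b (x0 - y) = a (x1 - y)] with
    [a = |x0 - y|] and [b = |x1 - y|]; this puts [y] on that line if
    [a != b], and forces [x0 = x1] if [a = b]. *)
Lemma off_line_ltr_enormD x0 x1 y (i j : 'I_n) : x0 ord0 i != x1 ord0 i ->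
  (y ord0 j - x0 ord0 j) * (x1 ord0 i - x0 ord0 i) !=
  (y ord0 i - x0 ord0 i) * (x1 ord0 j - x0 ord0 j) ->
  enorm ((x0 - y) + (x1 - y)) < enorm (x0 - y) + enorm (x1 - y).
Proof.
move=> xi det; rewrite ltNge; apply/negP => /enormD_eq_colinear.
set a := enorm (x0 - y); set b := enorm (x1 - y) => col.
have colE k : b * (x0 ord0 k - y ord0 k) = a * (x1 ord0 k - y ord0 k).
  by have /rowP/(_ k) := col; rewrite !mxE.
have ab : a = b.
  apply/eqP; rewrite -subr_eq0; move: det; apply: contraR => ab.
  rewrite -subr_eq0; apply/eqP/(mulfI ab); rewrite mulr0.
  have := colE i; have := colE j; rewrite !mulrBr => cj ci.
  have cj' : (a - b) * y ord0 j = a * x1 ord0 j - b * x0 ord0 j by lra.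
  have ci' : (a - b) * y ord0 i = a * x1 ord0 i - b * x0 ord0 i by lra.
  transitivity (((a - b) * y ord0 j - (a - b) * x0 ord0 j) *
                (x1 ord0 i - x0 ord0 i) -
                ((a - b) * y ord0 i - (a - b) * x0 ord0 i) *
                (x1 ord0 j - x0 ord0 j)); first by ring.
  by rewrite cj' ci'; ring.
have a0 : a = 0.
  have := colE i; rewrite -ab => /eqP; rewrite -subr_eq0 -mulrBr mulf_eq0.
  case/orP => [/eqP//|]; rewrite opprB addrA subrK subr_eq0.
  by rewrite (negbTE xi).
have yx0 : x0 = y by apply/eqP; rewrite -subr_eq0; apply/eqP/enorm_eq0.
have yx1 : x1 = y.
  by apply/eqP; rewrite -subr_eq0; apply/eqP/enorm_eq0; rewrite -/b -ab.
by move: xi; rewrite yx0 yx1 eqxx.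
Qed.

(** A point of the line leaves it when it is moved in a direction [j] different
    from a direction [i] in which [x0] and [x1] differ: the determinant is then
    changed by a nonzero multiple of [x1 i - x0 i].  This is where the
    dimension has to be at least [2]. *)
Lemma open_meets_off_line (A : set 'rV[R]_n) x0 x1 : (2 <= n)%N ->
  open A -> A !=set0 -> x0 != x1 ->
  exists2 y, A y &
    enorm ((x0 - y) + (x1 - y)) < enorm (x0 - y) + enorm (x1 - y).
Proof.
move=> n2 oA [a Aa] x01.
have [i xi] : exists i, x0 ord0 i != x1 ord0 i.
  apply/existsP; move: x01; apply: contraR; rewrite negb_exists => /forallP h.
  by apply/eqP/rowP => i; apply/eqP; have := h i; rewrite negbK.
have [j ji] : exists j : 'I_n, j != i.
  have /card_gt0P[j] : (0 < #|predC1 i|)%N.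
    by rewrite cardC1 card_ord -subn1 subn_gt0.
  by rewrite !inE; exists j.
have [det|det] := eqVneq ((a ord0 j - x0 ord0 j) * (x1 ord0 i - x0 ord0 i))
    ((a ord0 i - x0 ord0 i) * (x1 ord0 j - x0 ord0 j)); last first.
  by exists a => //; exact: off_line_ltr_enormD det.
move: (oA); rewrite openE => /(_ _ Aa) /nbhs_ballP[e /= e0 aeA].
pose b := a + (e / 2) *: delta_mx ord0 j.
have bE k : b ord0 k = a ord0 k + (e / 2) * (k == j)%:R by rewrite !mxE eqxx.
exists b.
  apply: aeA; split => // k l; rewrite (ord1 k) /ball/= bE opprD addNKr normrN.
  case: eqP => _; rewrite ?mulr0 ?mulr1 ?normr0// gtr0_norm; lra.
apply: (@off_line_ltr_enormD _ _ _ i j) => //.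
rewrite !bE eqxx [i == j]eq_sym (negbTE ji) mulr0 mulr1 addr0 -det.
rewrite -subr_eq0 -mulrBl mulf_neq0//; last by rewrite subr_eq0 eq_sym.
by rewrite opprB addrA; apply/lt0r_neq0; lra.
Qed.

End off_line.

(** * Lebesgue measure of bounded sets and of neighbourhoods *)

Section lebesgue_measure_rV.
Context (R : realType) (n : nat).
Implicit Types Omega : set 'rV[R]_n.
Local Notation nu := (lebesgue_rV R n).

Lemma compact_measurable_rV Omega : compact Omega -> measurable Omega.
Proof.
move=> /(compact_closed (@norm_hausdorff R 'rV[R]_n)) clO.
rewrite -(setCK Omega); apply: measurableC; apply: open_measurable_rV.
exact: closed_openC.
Qed.

Lemma lebesgue_rV_bounded Omega (rho : R) : measurable Omega ->
  (forall y, Omega y -> enorm y <= rho) -> (nu Omega < +oo)%E.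
Proof.
move=> mO Orho; pose c := `|rho|.
pose a : 'rV[R]_n := const_mx (- c); pose b : 'rV[R]_n := const_mx c.
pose B := [set x : 'rV[R]_n | forall i, x ord0 i \in `[a ord0 i, b ord0 i]].
have mB : measurable B.
  apply: (@measurable_box _ _ (fun i => `[a ord0 i, b ord0 i]%classic)) => i.
  exact: measurable_itv.
have OB : Omega `<=` B.
  move=> y Oy i; rewrite !mxE in_itv/= -ler_norml.
  apply: le_trans (ler_coord_enorm y i) _.
  by apply: le_trans (Orho _ Oy) _; exact: ler_norm.
apply: (@le_lt_trans _ _ (nu B)); first by apply: le_measure; rewrite ?inE.
rewrite [X in (X < _)%E]lebesgue_rV_box ?ltry// => i.
by rewrite !mxE ge0_cp// normr_ge0.
Qed.

Lemma nbhs_positive_measure (A : set 'rV[R]_n) (y : 'rV[R]_n) : nbhs y A ->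
  exists B : set 'rV[R]_n, [/\ measurable B, B `<=` A & (0 < nu B)%E].
Proof.
move=> /nbhs_ballP[e /= e0 yeA].
pose a := y - const_mx (e / 2); pose b := y + const_mx (e / 2).
exists [set x : 'rV[R]_n | forall i, x ord0 i \in `[a ord0 i, b ord0 i]]; split.
- apply: (@measurable_box _ _ (fun i => `[a ord0 i, b ord0 i]%classic)) => i.
  exact: measurable_itv.
- move=> x xB; apply: yeA; split => // i j; rewrite (ord1 i) /ball/=.
  have := xB j; rewrite !mxE in_itv/= => /andP[? ?].
  by rewrite ltr_norml; apply/andP; split; lra.
- rewrite lebesgue_rV_box => [|i]; last by rewrite !mxE; lra.
  by rewrite lte_fin prodr_gt0// => i _; rewrite !mxE; lra.
Qed.

End lebesgue_measure_rV.

(** * The potential *)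

Section potential.
Context (R : realType) (n : nat) (alpha : R) (Omega : set 'rV[R]_n).
Local Notation nu := (lebesgue_rV R n).
Local Notation p := (alpha - n%:R).

Hypothesis p1 : 1 <= p.
Hypothesis mO : measurable Omega.

Lemma measurable_kernel x :
  measurable_fun Omega (fun y : 'rV[R]_n => (enorm (x - y) `^ p)%:E).
Proof.
apply: measurable_funTS; apply/measurable_EFinP.
apply: continuous_measurable_rV.
exact: continuous_kernel.
Qed.

Lemma potential_le_add x z (c : R) : 0 <= c ->
  (forall y, Omega y -> enorm (x - y) `^ p <= enorm (z - y) `^ p + c) ->
  (potential alpha Omega x <= potential alpha Omega z + c%:E * nu Omega)%E.
Proof.
move=> c0 xz; rewrite -integral_cst// /potential -ge0_integralD//; last 2 first.
- by move=> y _; rewrite lee_fin powR_ge0.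
- exact: measurable_kernel.
apply: ge0_le_integral => //.
- by move=> y _; rewrite lee_fin powR_ge0.
- exact: measurable_kernel.
- by apply: emeasurable_funD => //; exact: measurable_kernel.
Qed.

Variable rho : R.
Hypothesis Orho : forall y, Omega y -> enorm y <= rho.

Lemma potential_fin_num x : potential alpha Omega x \is a fin_num.
Proof.
rewrite ge0_fin_numE; last first.
  by apply: integral_ge0 => y _; rewrite lee_fin powR_ge0.
pose c := (enorm x + rho) `^ p.
apply: (@le_lt_trans _ _ (c%:E * nu Omega)%E); last first.
  by rewrite lte_mul_pinfty ?lee_fin ?powR_ge0 ?(lebesgue_rV_bounded mO Orho).
rewrite -integral_cst//; apply: ge0_le_integral => //.
- by move=> y _; rewrite lee_fin powR_ge0.
- exact: measurable_kernel.
- move=> y Oy; rewrite lee_fin.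
  have le : enorm (x - y) <= enorm x + rho.
    by rewrite (le_trans (ler_enormD _ _))// enormN lerD2l Orho.
  apply: ge0_ler_powR => //; rewrite ?nnegrE ?enorm_ge0//.
    exact: le_trans ler01 p1.
  exact: le_trans (enorm_ge0 _) le.
Qed.

Lemma continuous_potential : continuous (fine \o potential alpha Omega).
Proof.
apply: locally_lipschitz_continuous => M.
pose C := (M + rho + 1) `^ p; exists (C * fine (nu Omega)) => x z xM zM /=.
have nufin : nu Omega \is a fin_num.
  by rewrite ge0_fin_numE// (lebesgue_rV_bounded mO Orho).
have le : (potential alpha Omega x <= potential alpha Omega z +
    (C * enorm (x - z))%:E * nu Omega)%E; last first.
  move: le; rewrite -(fineK (potential_fin_num x)).
  rewrite -(fineK (potential_fin_num z)).
  by rewrite -(fineK nufin) -EFinM -EFinD lee_fin mulrAC.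
apply: potential_le_add => [|y Oy].
  by rewrite mulr_ge0 ?powR_ge0 ?enorm_ge0.
have -> : x - z = (x - y) - (z - y) by apply/rowP => k; rewrite !mxE; ring.
have bd w : enorm w <= M -> enorm (w - y) <= M + rho.
  by move=> wM; rewrite (le_trans (ler_enormD _ _))// enormN lerD ?Orho.
by apply: enorm_powR_lipschitz => //; exact: bd.
Qed.

(** Each [y] in [Omega] satisfies [|y| <= rho < |x| - |y| <= |x - y|]. *)
Lemma potential_origin_le x : 2 * rho < enorm x ->
  (potential alpha Omega 0 <= potential alpha Omega x)%E.
Proof.
move=> rx; have := @potential_le_add 0 x 0; rewrite mul0e adde0.
apply => // y Oy.
rewrite addr0 sub0r enormN; apply: ge0_ler_powR; rewrite ?nnegrE ?enorm_ge0//.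
  exact: le_trans ler01 p1.
have := ler_enormD (x - y) y; rewrite subrK => tri.
by have := Orho Oy; lra.
Qed.

Lemma exists_center : Omega !=set0 -> exists x, is_center alpha Omega x.
Proof.
move=> [y0 Oy0].
have rho0 : 0 <= rho by exact: le_trans (enorm_ge0 _) (Orho Oy0).
(* A cube rather than a ball: its compactness is that of a product of
   segments, and a point outside it has Euclidean norm above [2 rho]. *)
pose S : set R := `[- (2 * rho), 2 * rho]%classic.
pose K := [set x : 'rV[R]_n | forall i, S (x ord0 i)].
have K0 : K 0 by move=> i; rewrite mxE /S /= in_itv/=; apply/andP; split; lra.
have cK : compact K.
  by apply: (@rV_compact R n (fun=> S)) => i; exact: segment_compact.
have [c _ cmin] := EVT_min_rV (ex_intro _ _ K0) cK
  (continuous_subspaceT continuous_potential).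
have cminE x : K x -> (potential alpha Omega c <= potential alpha Omega x)%E.
  move=> Kx; have := cmin x (mem_set Kx).
  rewrite -(fineK (potential_fin_num c)) -(fineK (potential_fin_num x)).
  by rewrite lee_fin.
exists c => z; have [Kz|nKz] := pselect (K z); first exact: cminE.
apply: le_trans (cminE _ K0) _; apply: potential_origin_le.
rewrite ltNge; apply/negP => zr; apply: nKz => i.
by rewrite /S /= in_itv/= -ler_norml (le_trans (ler_coord_enorm _ _)).
Qed.

(** The pointwise midpoint inequality is strict at an interior point of [Omega]
    off the line through [x0] and [x1], and by continuity with a uniform gap on
    a set [B] of positive measure around it. *)
Lemma potential_midpoint_lt x0 x1 : (2 <= n)%N -> Omega° !=set0 -> x0 != x1 ->
  (2%:E * potential alpha Omega (2^-1 *: (x0 + x1)) <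
   potential alpha Omega x0 + potential alpha Omega x1)%E.
Proof.
move=> n2 O0 x01.
have [y Oy ylt] := open_meets_off_line n2 (@open_interior _ Omega) O0 x01.
set mid := 2^-1 *: (x0 + x1).
have midE w : mid - w = 2^-1 *: ((x0 - w) + (x1 - w)).
  by apply/rowP => k; rewrite !mxE; field.
pose h (x w : 'rV[R]_n) := enorm (x - w) `^ p.
pose gap w := h x0 w + h x1 w - 2 * h mid w.
have gap0 w : 0 <= gap w by rewrite subr_ge0 /h midE kernel_midpoint_le.
have gapy : 0 < gap y by rewrite subr_gt0 /h midE kernel_midpoint_lt.
have ch x : continuous (h x) by exact: continuous_kernel.
have cgap : continuous gap.
  move=> w; have Fw : Filter (nbhs w) by exact: (@nbhs_filter 'rV[R]_n w).
  have c01 := cvgD (ch x0 w) (ch x1 w).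
  exact: cvgB (c01 Fw) (cvgM (cvg_cst (2 : R)) (ch mid w)).
have nbhs_gap : \forall w \near y, gap y / 2 <= gap w.
  by apply: (@cvgr_ge _ _ (nbhs y) _ gap (gap y) (cgap y)); lra.
have [B [mB BA B0]] :=
  nbhs_positive_measure (filterI (Oy : nbhs y Omega) nbhs_gap).
have mh x := measurable_kernel x.
have h0 x w : (0 <= (h x w)%:E)%E by rewrite lee_fin powR_ge0.
have c0 : 0 <= gap y / 2 by rewrite divr_ge0.
apply: (@lt_le_trans _ _
    (2%:E * potential alpha Omega mid + (gap y / 2)%:E * nu B)%E).
  rewrite lteDl ?fin_numM ?potential_fin_num//.
  by rewrite mule_gt0// lte_fin divr_gt0.
have -> : nu B = (\int[nu]_(w in Omega) (\1_B w)%:E)%E.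
  by rewrite integral_indic//; congr (nu _); apply/esym/setIidl => w /BA[].
have m1 : measurable_fun Omega (fun w : 'rV[R]_n => (\1_B w : R)%:E).
  by apply/measurable_EFinP; apply: measurable_funTS; exact: measurable_indic.
rewrite /potential -!ge0_integralZl_EFin//; last by move=> w _; exact: h0.
have mgapB := measurable_funeM (gap y / 2)%:E m1.
have mmid := measurable_funeM 2%:E (mh mid).
have hmid0 w : Omega w -> (0 <= 2%:E * (enorm (mid - w) `^ p)%:E)%E.
  by move=> _; rewrite mule_ge0// lee_fin ?powR_ge0.
have hB0 w : Omega w -> (0 <= (gap y / 2)%:E * (\1_B w)%:E)%E.
  by move=> _; rewrite mule_ge0// lee_fin.
rewrite -!ge0_integralD//; try by move=> w _; exact: h0.
apply: (ge0_le_integral nu mO).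
- by move=> w Ow; exact: adde_ge0 (hmid0 _ Ow) (hB0 _ Ow).
- exact: emeasurable_funD mmid mgapB.
- exact: emeasurable_funD (mh x0) (mh x1).
move=> w _; rewrite -!EFinM -!EFinD lee_fin addrC -lerBrDr -/(gap w).
have [Bw|nBw] := boolP (w \in B).
  by rewrite indicE Bw mulr1; have [] := BA _ (set_mem Bw).
rewrite indicE (negbTE nBw) mulr0; exact: gap0.
Qed.

Lemma center_unique x0 x1 : (2 <= n)%N -> Omega° !=set0 ->
  is_center alpha Omega x0 -> is_center alpha Omega x1 -> x0 = x1.
Proof.
move=> n2 O0 x0min x1min; apply/eqP; apply: contrapT => /negP x01.
have := potential_midpoint_lt n2 O0 x01; rewrite ltNge => /negP; apply.
rewrite (mule_natl _ 2) mule2n; exact: leeD (x0min _) (x1min _).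
Qed.

End potential.

(** * Existence and uniqueness of the center *)

Theorem theorem3p15 (R : realType) (m : nat) (alpha : R)
    (hm : (2 <= m)%N) (halpha : m%:R + 1 <= alpha)
    (Omega : set 'rV[R]_m) (hbody : is_body Omega)
    (hboundary : piecewise_C1 (boundary Omega)) :
  exists! x : 'rV[R]_m, is_center alpha Omega x.
Proof.
case: hbody => Omega0 cptOmega regOmega.
have p1 : 1 <= alpha - m%:R by rewrite lerBrDl.
have mOmega := compact_measurable_rV cptOmega.
(* A radius [enorm c] of a ball about [0] that contains [Omega]. *)
have [c _ cmax] := EVT_max_rV Omega0 cptOmega
  (continuous_subspaceT (@continuous_enorm R m)).
have bOmega y : Omega y -> enorm y <= enorm c.
  by move=> Oy; exact/cmax/mem_set.
(* Otherwise [Omega], the closure of its interior, would be empty. *)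
have intOmega : Omega° !=set0.
  apply/set0P/negP => /eqP int0.
  by move: Omega0; rewrite -regOmega int0 closure0 => -[].
have [x xmin] := exists_center p1 mOmega bOmega Omega0.
exists x; split => // z zmin.
have xz := center_unique p1 mOmega bOmega hm intOmega xmin zmin.
exact: xz.
Qed.
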